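(* Let $b_1,b_2\in[0,1]$ and $n\in\mathbb{Z}_{\ge1}$. Then $\mathsf{L}^n$ is a stochastic matrix: all its entries are non-negative, and for any $\mathbf{i},\mathbf{j}\in\{0,1\}^n$, $$\sum_{\mathbf{k},\mathbf{l}\in\{0,1\}^n}\mathsf{L}^n(\mathbf{i},\mathbf{j};\mathbf{k},\mathbf{l})=1.$$
   Context: Boolean-type product. Regard $b_1,b_2$ as indeterminates and let $W'=\{0,1,b_1,b_2,1-b_1,1-b_2\}$ and $W=W'\cup\{b_1b_2,\,b_1(1-b_2),\,(1-b_1)b_2,\,(1-b_1)(1-b_2)\}$. For $x\in W$ let $[x]$ be its set of factors: $[x]=\{x\}$ if $x\in W'$, $[b_1b_2]=\{b_1,b_2\}$, $[b_1(1-b_2)]=\{b_1,1-b_2\}$, $[(1-b_1)b_2]=\{1-b_1,b_2\}$, $[(1-b_1)(1-b_2)]=\{1-b_1,1-b_2\}$. For $x,y\in W$ set $x*y=0$ if $\{b_1,1-b_1\}\subseteq[x]\cup[y]$ or $\{b_2,1-b_2\}\subseteq[x]\cup[y]$, and $x*y=\prod_{z\in[x]\cup[y]}z$ otherwise. The product $*$ is commutative and associative on $W$; $\prod^*$ denotes the product of several terms under $*$. Matrix $\mathsf{L}^1$ (indexed by $i,j,k,l\in\{0,1\}$, the numbers of lines at the bottom, left, top, right of a vertex): $\mathsf{L}^1(1,0;1,0)=1$, $\mathsf{L}^1(0,1;0,1)=1$, $\mathsf{L}^1(0,0;0,0)=b_2$, $\mathsf{L}^1(0,0;1,1)=1-b_2$,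 $\mathsf{L}^1(1,1;1,1)=b_1$, $\mathsf{L}^1(1,1;0,0)=1-b_1$, and all other entries are $0$. For $\mathbf{x}\in\{0,1\}^n$ and $r\in\{1,\dots,n\}$ let $\mathfrak{s}_r(\mathbf{x})=\big(\sum_{m=1}^r x_m\big)\bmod 2\in\{0,1\}$. For $\mathbf{i},\mathbf{j},\mathbf{k},\mathbf{l}\in\{0,1\}^n$ define $$\mathsf{L}^n(\mathbf{i},\mathbf{j};\mathbf{k},\mathbf{l})=\prod^{*}_{r\in\{1,\dots,n\}}\mathsf{L}^1\big(\mathfrak{s}_r(\mathbf{i}),\mathfrak{s}_r(\mathbf{j});\mathfrak{s}_r(\mathbf{k}),\mathfrak{s}_r(\mathbf{l})\big)\in W,$$ with rows indexed by $(\mathbf{i},\mathbf{j})$ and columns by $(\mathbf{k},\mathbf{l})$; the product $*$ is computed formally in $W$, and the resulting element is then evaluated at the given numbers $b_1,b_2\in[0,1]$. *)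

(* Defs.v *)
From mathcomp Require Import all_boot all_order all_algebra.
From mathcomp.multinomials Require Import mpoly.

Set Implicit Arguments.
Unset Strict Implicit.
Unset Printing Implicit Defensive.

Import Order.TTheory GRing.Theory Num.Theory.

Local Open Scope ring_scope.

Section BooleanProduct.
Variable R : comNzRingType.

Definition B1 : {mpoly R[2]} := 'X_(ord0 : 'I_2).
Definition B2 : {mpoly R[2]} := 'X_(ord_max : 'I_2).

Definition W' : seq {mpoly R[2]} :=
  [:: 0; 1; B1; B2; 1 - B1; 1 - B2].

Definition W : seq {mpoly R[2]} :=
  W' ++ [:: B1 * B2; B1 * (1 - B2); (1 - B1) * B2; (1 - B1) * (1 - B2)].

(* Only the values on W matter; polynomials outside W get the singleton. *)
Definition factors (x : {mpoly R[2]}) : seq {mpoly R[2]} :=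
  if x == B1 * B2 then [:: B1; B2]
  else if x == B1 * (1 - B2) then [:: B1; 1 - B2]
  else if x == (1 - B1) * B2 then [:: 1 - B1; B2]
  else if x == (1 - B1) * (1 - B2) then [:: 1 - B1; 1 - B2]
  else [:: x].

(* A factor common to x and y counts once in the product, whence undup. *)
Definition wstar (x y : {mpoly R[2]}) : {mpoly R[2]} :=
  let F := undup (factors x ++ factors y) in
  if (B1 \in F) && (1 - B1 \in F) || (B2 \in F) && (1 - B2 \in F) then 0
  else \prod_(z <- F) z.

(* Arguments: bottom, left, top, right. *)
Definition L1 (i j k l : bool) : {mpoly R[2]} :=
  match i, j, k, l with
  | true,  false, true,  false => 1
  | false, true,  false, true  => 1
  | false, false, false, false => B2
  | false, false, true,  true  => 1 - B2
  | true,  true,  true,  true  => B1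
  | true,  true,  false, false => 1 - B1
  | _, _, _, _ => 0
  end.

(* Here r : 'I_n is zero-based, so the partial sum runs over m <= r. *)
Definition psum2 (n : nat) (r : 'I_n) (x : {ffun 'I_n -> bool}) : bool :=
  odd (\sum_(m < n | (m <= r)%N) x m)%N.

(* By wstar_W, wstar1, wstarC and wstarA below, wstar is a commutative monoid law
   with unit 1 on W, so this product is independent of order and bracketing. *)
Definition LnW (n : nat) (i j k l : {ffun 'I_n -> bool}) : {mpoly R[2]} :=
  \big[wstar/1]_(r < n) L1 (psum2 r i) (psum2 r j) (psum2 r k) (psum2 r l).

Definition Ln (b1 b2 : R) (n : nat) (i j k l : {ffun 'I_n -> bool}) : R :=
  (LnW i j k l).@[fun v : 'I_2 => if v == ord0 then b1 else b2].

(* Evaluation at the four points of {0,1}^2 identifies W with ten boolean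
   functions of (b1, b2), on which wstar is the pointwise conjunction; this
   yields the closure, unit, commutativity and associativity laws. *)
Definition Wn (i : nat) : {mpoly R[2]} :=
  nth 0 [:: 0; 1; B1; B2; 1 - B1; 1 - B2;
            B1 * B2; B1 * (1 - B2); (1 - B1) * B2; (1 - B1) * (1 - B2)] i.

Definition bpt (a b : bool) : 'I_2 -> R := fun v => if v == ord0 then a%:R else b%:R.

Definition bvals (p : {mpoly R[2]}) : seq bool :=
  [seq p.@[bpt c.1 c.2] == 1 |
    c <- [:: (false, false); (false, true); (true, false); (true, true)]].

Definition bvalsW (i : nat) : seq bool :=
  let f := fun a b => nth false [:: false; true; a; b; ~~ a; ~~ b;
    a && b; a && ~~ b; ~~ a && b; ~~ a && ~~ b] i in
  [:: f false false; f false true; f true false; f true true].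

Lemma bvalsE i : (i < 10)%N -> bvals (Wn i) = bvalsW i.
Proof.
have n01 : ((0 : R) == 1) = false by rewrite eq_sym oner_eq0.
have h : forall a b : bool, (B1).@[bpt a b] = a%:R /\ (B2).@[bpt a b] = b%:R.
  by move=> a b; rewrite /B1 /B2 !mevalXU.
move=> i10; do 10! [case: i i10 => [|i] i10;
  first by rewrite /bvals /Wn /bvalsW /= ?(mevalM, mevalB, meval1, meval0);
    rewrite ?(fun a b => proj1 (h a b), fun a b => proj2 (h a b));
    rewrite /= ?(subr0, subrr, mulr0, mul0r, mulr1, mul1r, n01, eqxx)].
by [].
Qed.

Lemma Wn_inj i j : (i < 10)%N -> (j < 10)%N -> Wn i = Wn j -> i = j.
Proof.
move=> i10 j10 eq_w; move: (congr1 bvals eq_w); rewrite !bvalsE // {eq_w}.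
by do 10! [case: i i10 => [|i] i10;
  first by do 10! [case: j j10 => [|j] j10 //]].
Qed.

Lemma W_map : W = [seq Wn i | i <- iota 0 10].
Proof. by []. Qed.

Lemma W_P x : x \in W -> exists2 i, (i < 10)%N & x = Wn i.
Proof. by rewrite W_map => /mapP[i]; rewrite mem_iota => hi ->; exists i. Qed.

Lemma Wn_W i : (i < 10)%N -> Wn i \in W.
Proof. by move=> hi; rewrite W_map map_f // mem_iota. Qed.

Definition facW (i : nat) : seq nat :=
  nth [::] [:: [:: 0]; [:: 1]; [:: 2]; [:: 3]; [:: 4]; [:: 5];
     [:: 2; 3]; [:: 2; 5]; [:: 4; 3]; [:: 4; 5]]%N i.

Lemma Wn_eq i j : (i < 10)%N -> (j < 10)%N -> (Wn i == Wn j) = (i == j).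
Proof. by move=> hi hj; apply/eqP/eqP => [/Wn_inj->|->]. Qed.

Lemma factorsE i : (i < 10)%N -> factors (Wn i) = map Wn (facW i).
Proof.
move=> i10; rewrite /factors.
rewrite -[B1 * B2]/(Wn 6) -[B1 * (1 - B2)]/(Wn 7).
rewrite -[(1 - B1) * B2]/(Wn 8) -[(1 - B1) * (1 - B2)]/(Wn 9) !Wn_eq //.
by do 10! [case: i i10 => [_|i i10];
  first by []].
Qed.

Lemma facW_lt i k : k \in facW i -> (k < 10)%N.
Proof.
have /allP h : all (fun k => (k < 10)%N) (facW i).
  by do 10! [case: i => [//|i]]; rewrite /facW nth_default.
exact: h.
Qed.

Lemma wstarE i j : (i < 10)%N -> (j < 10)%N ->
  let s := facW i ++ facW j in
  wstar (Wn i) (Wn j) =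
   if (2 \in s) && (4 \in s) || (3 \in s) && (5 \in s) then 0
   else \prod_(k <- undup s) Wn k.
Proof.
move=> hi hj s; rewrite /wstar !factorsE // -map_cat -/s.
have sl k : k \in s -> (k < 10)%N by rewrite mem_cat => /orP[] /facW_lt.
have inj_s : {in s &, injective Wn} by move=> a b /sl ha /sl hb; apply: Wn_inj.
have ms k : (k < 10)%N -> (Wn k \in undup (map Wn s)) = (k \in s).
  move=> hk; rewrite mem_undup.
  apply/idP/idP => [/mapP[l ls e]|ks]; last exact: map_f.
  by rewrite (Wn_inj hk (sl _ ls) e).
rewrite -[B1]/(Wn 2) -[B2]/(Wn 3) -[1 - Wn 2]/(Wn 4).
rewrite -[1 - Wn 3]/(Wn 5) !ms //; case: ifP => // _.
rewrite -(big_map Wn predT id); apply: perm_big; apply: uniq_perm.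
- exact: undup_uniq.
- by rewrite map_inj_in_uniq ?undup_uniq // => a b; rewrite !mem_undup;
    apply: inj_s.
move=> z; rewrite mem_undup; apply/mapP/mapP => -[k ks ->]; exists k => //.
  by rewrite mem_undup.
by rewrite -mem_undup.
Qed.

Definition andW (i j : nat) : nat :=
  find (fun k => bvalsW k ==
    [seq x.1 && x.2 | x <- zip (bvalsW i) (bvalsW j)]) (iota 0 10).

Lemma wstar_andW i j : (i < 10)%N -> (j < 10)%N ->
  (andW i j < 10)%N /\ wstar (Wn i) (Wn j) = Wn (andW i j).
Proof.
move=> hi hj; rewrite wstarE //.
by do 10! [case: i hi => [|i] hi;
  first by do 10! [case: j hj => [|j] hj;
    first by split=> //=; rewrite ?big_cons ?big_nil /Wn /=
      ?(mulr1, mul1r, mul0r, mulr0) // mulrC]].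
Qed.

Lemma bvalsW_and i j : (i < 10)%N -> (j < 10)%N ->
  bvalsW (andW i j) = [seq x.1 && x.2 | x <- zip (bvalsW i) (bvalsW j)].
Proof.
by do 10! [case: i => [|i]; first by do 10! [case: j => [//|j]]].
Qed.

Lemma wstar_W x y : x \in W -> y \in W -> wstar x y \in W.
Proof.
by move=> /W_P[i hi ->] /W_P[j hj ->]; case: (wstar_andW hi hj) => h ->;
  apply: Wn_W.
Qed.

Lemma wstar1 x : x \in W -> wstar x 1 = x.
Proof.
move=> /W_P[i hi ->]; rewrite -[1]/(Wn 1).
case: (wstar_andW hi (isT : 1 < 10)%N) => _ ->.
by do 10! [case: i hi => [//|i] hi].
Qed.

Lemma wstarC x y : x \in W -> y \in W -> wstar x y = wstar y x.
Proof.
move=> /W_P[i hi ->] /W_P[j hj ->].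
case: (wstar_andW hi hj) => _ ->; case: (wstar_andW hj hi) => _ ->; congr Wn.
by rewrite /andW; apply: eq_find => k; rewrite /bvalsW /= !(andbC (nth _ _ j)).
Qed.

Lemma wstarA x y z : x \in W -> y \in W -> z \in W ->
  wstar x (wstar y z) = wstar (wstar x y) z.
Proof.
move=> /W_P[i hi ->] /W_P[j hj ->] /W_P[k hk ->].
case: (wstar_andW hi hj) => ij ->; case: (wstar_andW hj hk) => jk ->.
case: (wstar_andW hi jk) => _ ->; case: (wstar_andW ij hk) => _ ->; congr Wn.
rewrite /andW -!/(andW _ _); apply: eq_find => l; congr (_ == _).
by rewrite !bvalsW_and //= !andbA.
Qed.

Lemma LnW_W (n : nat) (i j k l : {ffun 'I_n -> bool}) : LnW i j k l \in W.
Proof.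
rewrite /LnW; elim/big_ind: _ => //; first exact: Wn_W 1%N isT.
  exact: wstar_W.
move=> r _; case: (psum2 r i) (psum2 r j) (psum2 r k) (psum2 r l) => [] [] [] [];
  by rewrite /L1 !inE eqxx ?orbT.
Qed.

End BooleanProduct.

(* Main.v *)
Require Import Defs.
From mathcomp Require Import all_boot all_order all_algebra.
From mathcomp.multinomials Require Import mpoly.
From mathcomp Require Import ring.

Set Implicit Arguments.
Unset Strict Implicit.
Unset Printing Implicit Defensive.

Import Order.TTheory GRing.Theory Num.Theory.

Local Open Scope ring_scope.

(** Let the two indeterminates be independent Bernoulli variables with success
    probabilities [b1] and [b2]. An element of [W] is affine in each
    indeterminate, so its value at [(b1, b2)] is the expectation of its value at
    the four points of [{0,1}^2] ([meval_expectation]); there it is the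
    indicator of an event, and [wstar] is the intersection of events
    ([meval_wstar]). Hence [Ln b1 b2 i j k l] is a mixture, with weights
    independent of [i], [j], [k] and [l], of ordinary products of [0/1]-valued
    vertex weights ([Ln_mixture]), and is nonnegative.

    Once the Bernoulli variables are fixed, a vertex is deterministic: the
    incoming pair (bottom, left) forces the outgoing pair (top, right)
    ([meval_L1]). The prefix-parity map [x |-> (psum2 r x)_r] is a bijection of
    [{0,1}^n] ([parities_inj]), so for given [i] and [j] exactly one pair
    [(k, l)] has product [1]: every matrix in the mixture has row sums [1]
    ([sum_vertex_indicator]), and therefore so does [Ln]. *)

Section Mixture.
Variable R : comNzRingType.

Definition bernoulli_mass (p : R) (a : bool) : R := if a then p else 1 - p.

Definition pt (b1 b2 : R) : 'I_2 -> R := fun v => if v == ord0 then b1 else b2.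

Lemma bernoulli_mass_sum (p : R) : \sum_(a : bool) bernoulli_mass p a = 1.
Proof. by rewrite big_bool /=; ring. Qed.

(** This also evaluates at the points of [{0,1}^2], because [bpt R a b] is
    convertible to [pt a%:R b%:R]. *)
Lemma meval_B (b1 b2 : R) :
  ((B1 R).@[pt b1 b2] = b1) * ((B2 R).@[pt b1 b2] = b2).
Proof. by split; rewrite /B1 /B2 mevalXU. Qed.

(** Elements of [W] are products of affine polynomials in distinct
    indeterminates, and such a product is recovered from its values on
    [{0,1}^2] by bilinear interpolation. *)
Lemma meval_expectation (b1 b2 : R) (x : {mpoly R[2]}) : x \in W R ->
  x.@[pt b1 b2] =
  \sum_(a : bool) \sum_(b : bool)
     bernoulli_mass b1 a * bernoulli_mass b2 b * x.@[bpt R a b].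
Proof.
move=> /W_P[i hi ->]; rewrite !big_bool /bernoulli_mass.
do 10! [case: i hi => [|i] hi;
  first by rewrite /Wn /= ?(mevalM, mevalB, meval1, meval0)
    ?meval_B /=; ring].
by [].
Qed.

Lemma meval_bvals (x : {mpoly R[2]}) (a b : bool) : x \in W R ->
  x.@[bpt R a b] = (nth false (bvals x) (a.*2 + b))%:R.
Proof.
move=> /W_P[i hi ->]; rewrite bvalsE //.
do 10! [case: i hi => [|i] hi;
  first by rewrite /Wn /= ?(mevalM, mevalB, meval1, meval0)
    ?meval_B; case: a; case: b; rewrite /= ?(subr0, subrr, mulr0, mul0r, mulr1)].
by [].
Qed.

(** On [{0,1}^2] a repeated factor is idempotent and complementary factors
    multiply to [0], which are the two ways [wstar] departs from the product. *)
Lemma meval_wstar (x y : {mpoly R[2]}) (a b : bool) : x \in W R -> y \in W R ->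
  (wstar x y).@[bpt R a b] = x.@[bpt R a b] * y.@[bpt R a b].
Proof.
move=> xW yW; rewrite !meval_bvals ?wstar_W // -natrM mulnb; congr (_%:R).
move: xW yW => /W_P[i hi ->] /W_P[j hj ->].
have [hij ->] := wstar_andW R hi hj; rewrite !bvalsE // bvalsW_and //.
by case: a; case: b.
Qed.

Lemma L1_W (i j k l : bool) : L1 R i j k l \in W R.
Proof. by move: i j k l => [] [] [] []; rewrite /L1 !inE eqxx ?orbT. Qed.

Lemma meval_LnW (n : nat) (i j k l : {ffun 'I_n -> bool}) (a b : bool) :
  (LnW R i j k l).@[bpt R a b] =
  \prod_(r < n)
     (L1 R (psum2 r i) (psum2 r j) (psum2 r k) (psum2 r l)).@[bpt R a b].
Proof.
pose K (x : {mpoly R[2]}) (y : R) := x \in W R /\ x.@[bpt R a b] = y.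
suff [] : K (LnW R i j k l) (\prod_(r < n)
     (L1 R (psum2 r i) (psum2 r j) (psum2 r k) (psum2 r l)).@[bpt R a b]) by [].
rewrite /LnW; apply: (big_ind2 K) => [|x1 x2 y1 y2 [xW <-] [yW <-]|r _].
- by split; [exact: (Wn_W R (isT : 1 < 10)%N) | exact: meval1].
- by split; [exact: wstar_W | exact: meval_wstar].
- by split; first exact: L1_W.
Qed.

(** The (top, right) pair leaving a vertex entered by the (bottom, left) pair
    [(i, j)], when the two Bernoulli variables take the values [a] and [b]. A
    single line goes straight; for two lines [a] decides, and for none [b],
    whether the vertex keeps their number or flips it. *)
Definition vertex_out (a b i j : bool) : bool * bool :=
  if i == j then let c := if i then a else ~~ b in (c, c) else (i, j).

Lemma meval_L1 (a b i j k l : bool) :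
  (L1 R i j k l).@[bpt R a b] = ((k, l) == vertex_out a b i j)%:R.
Proof.
by case: i; case: j; case: k; case: l;
  rewrite /L1 ?(mevalB, meval1, meval0) ?meval_B;
  case: a; case: b; rewrite /= ?(subr0, subrr).
Qed.

Lemma Ln_mixture (b1 b2 : R) (n : nat) (i j k l : {ffun 'I_n -> bool}) :
  Ln b1 b2 i j k l =
  \sum_(a : bool) \sum_(b : bool) bernoulli_mass b1 a * bernoulli_mass b2 b *
    [forall r, (psum2 r k, psum2 r l) ==
               vertex_out a b (psum2 r i) (psum2 r j)]%:R.
Proof.
rewrite /Ln -/(pt b1 b2) meval_expectation ?LnW_W //.
apply: eq_bigr => a _; apply: eq_bigr => b _; congr (_ * _).
rewrite meval_LnW; under eq_bigr do rewrite meval_L1.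
case: forallP => [all_eq | /forallP/forallPn[r /negPf ne_r]].
  by apply: big1 => r _; rewrite all_eq.
by rewrite (bigD1 r) //= ne_r mul0r.
Qed.

Definition parities (n : nat) (x : {ffun 'I_n -> bool}) : {ffun 'I_n -> bool} :=
  [ffun r => psum2 r x].

(** Given the entries before [r], the parity of the prefix ending at [r]
    determines the entry at [r]. *)
Lemma parities_inj (n : nat) : injective (@parities n).
Proof.
move=> x y eq_xy; apply/ffunP => r; have [m] := ubnP (r : nat).
elim: m r => // m IHm r; rewrite ltnS => le_rm.
move/ffunP/(_ r): eq_xy; rewrite !ffunE /psum2.
rewrite (bigD1 r) //= [X in _ = odd X](bigD1 r) //= !oddD.
rewrite (eq_bigr (fun t => y t : nat)) => [/addIb|t /andP[le_tr ne_tr]].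
  by rewrite !oddb.
by rewrite IHm // (leq_trans _ le_rm) // ltn_neqAle le_tr andbT.
Qed.

Lemma sum_parities_indicator (n : nat) (x : {ffun 'I_n -> bool}) :
  \sum_(k : {ffun 'I_n -> bool}) (parities k == x)%:R = 1 :> R.
Proof.
have bij : bijective (@parities n) := injF_bij (@parities_inj n).
rewrite -(reindex (@parities n) (P := predT) (F := fun k => (k == x)%:R)) /=;
  last exact: onW_bij.
by rewrite (bigD1 x) //= eqxx big1 ?addr0 // => k /negPf->.
Qed.

Lemma sum_vertex_indicator (n : nat) (out : 'I_n -> bool * bool) :
  \sum_(k : {ffun 'I_n -> bool}) \sum_(l : {ffun 'I_n -> bool})
    [forall r, (psum2 r k, psum2 r l) == out r]%:R = 1 :> R.
Proof.
pose K := [ffun r => (out r).1]; pose L := [ffun r => (out r).2].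
have split_out k l : [forall r, (psum2 r k, psum2 r l) == out r] =
    (parities k == K) && (parities l == L).
  apply/forallP/andP => [eq_out | [/eqP/ffunP eqK /eqP/ffunP eqL] r].
    by split; apply/eqP/ffunP => r; rewrite !ffunE -(eqP (eq_out r)).
  move: (eqK r) (eqL r); rewrite !ffunE => -> ->.
  by rewrite -surjective_pairing.
under eq_bigr => k _ do under eq_bigr => l _ do
  rewrite split_out -mulnb natrM.
under eq_bigr => k _ do rewrite -mulr_sumr sum_parities_indicator mulr1.
exact: sum_parities_indicator.
Qed.

Lemma Ln_row_sum (b1 b2 : R) (n : nat) (i j : {ffun 'I_n -> bool}) :
  \sum_(k : {ffun 'I_n -> bool}) \sum_(l : {ffun 'I_n -> bool})
    Ln b1 b2 i j k l = 1.
Proof.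
under eq_bigr => k _ do under eq_bigr => l _ do
  rewrite Ln_mixture pair_big /=.
under eq_bigr => k _ do rewrite exchange_big /=.
rewrite exchange_big /=.
under eq_bigr => ab _ do under eq_bigr => k _ do rewrite -mulr_sumr.
under eq_bigr => ab _ do rewrite -mulr_sumr sum_vertex_indicator mulr1.
rewrite -(pair_big predT predT (fun a b =>
  bernoulli_mass b1 a * bernoulli_mass b2 b)) /=.
by rewrite -big_distrlr /= !bernoulli_mass_sum mulr1.
Qed.

End Mixture.

Lemma bernoulli_mass_ge0 (R : realFieldType) (p : R) (a : bool) :
  0 <= p <= 1 -> 0 <= bernoulli_mass p a.
Proof. by case/andP=> p0 p1; case: a; rewrite //= subr_ge0. Qed.

Theorem proposition2p4 (R : realFieldType) (b1 b2 : R)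
    (hb1 : 0 <= b1 <= 1) (hb2 : 0 <= b2 <= 1) (n : nat) (hn : (1 <= n)%N) :
  (forall i j k l : {ffun 'I_n -> bool}, 0 <= Ln b1 b2 i j k l) /\
  (forall i j : {ffun 'I_n -> bool},
     \sum_(k : {ffun 'I_n -> bool}) \sum_(l : {ffun 'I_n -> bool})
       Ln b1 b2 i j k l = 1).
Proof.
split=> [i j k l | i j]; last exact: Ln_row_sum.
rewrite Ln_mixture; apply: sumr_ge0 => a _; apply: sumr_ge0 => b _.
by rewrite !mulr_ge0 ?bernoulli_mass_ge0 ?ler0n.
Qed.
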